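(* Let $\chi$ be an uncountable limit cardinal, and let $\lambda$ be a cardinal with $\chi < \lambda < \chi^{+\chi}$. Then $\chi$ is $\lambda$-pcf-strong. Furthermore, $\mathrm{cov}(\lambda, \chi^+, \chi^+, \sigma) \leq \lambda$ for some cardinal $\sigma < \chi$.
   Context: $\chi^{+\alpha}$ denotes the $\alpha$-th cardinal successor of $\chi$ (if $\chi=\aleph_\gamma$ then $\chi^{+\alpha}=\aleph_{\gamma+\alpha}$). For a set $S$ and a cardinal $\tau$, $P_\tau(S)=\{x\subseteq S : |x|<\tau\}$. For cardinals $\rho_1,\rho_2,\rho_3,\rho_4$ with $\rho_1^+\geq\rho_2$, $\rho_2^+\geq\rho_3\geq\omega$ and $\rho_3\geq\rho_4\geq 2$, the covering number $\mathrm{cov}(\rho_1,\rho_2,\rho_3,\rho_4)$ is the least cardinality of any $X\subseteq P_{\rho_2}(\rho_1)$ such that for any $b\in P_{\rho_3}(\rho_1)$ there is $Q\in P_{\rho_4}(X)$ with $b\subseteq\bigcup Q$. For a nonempty set $A$ of regular (infinite) cardinals, $\prod A=\prod_{a\in A}a$ is the set of functions $f$ on $A$ with $f(a)\in a$ for all $a \in A$. Ideals are proper. For an ideal $I$ on $A$ and $f,g\in\prod A$, $f<_I g$ means $\{a\in A: f(a)\geq g(a)\}\in I$. For a regular cardinal $\pi$, $\mathrm{tcf}(\prod A/I)=\pi$ means that there is an increasing, cofinal sequence $\langle f_\alpha:\alpha<\pi\rangle$ in $(\prod A,<_I)$. For an infinite cardinal $\sigma$, $\mathrm{pcf}_{\sigma\text{-com}}(A)$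 is the collection of all cardinals $\pi$ such that $\pi=\mathrm{tcf}(\prod A/I)$ for some $\sigma$-complete ideal $I$ on $A$ ($\sigma$-complete: closed under unions of fewer than $\sigma$ members). For infinite cardinals $\tau,\rho,\theta$, $\mathrm{Reg}(\tau,\rho,\theta)$ is the collection of all sets $A$ of regular cardinals such that $0<|A|<\tau$ and $\rho<\nu<\theta$ for all $\nu\in A$. For infinite cardinals $\chi\leq\lambda$, $\chi$ is $\lambda$-pcf-strong if for every large enough (infinite) cardinal $\sigma<\chi$, $|\lambda\cap\mathrm{pcf}_{\sigma\text{-com}}(A)|<\chi$ for all $A\in\mathrm{Reg}(\chi,\chi,\lambda)$. *)

(* Defs.v *)
From HB Require Import structures.
From mathcomp Require Import all_boot all_order.
From mathcomp Require Import boolp classical_sets functions cardinality.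

Set Implicit Arguments.
Unset Strict Implicit.
Unset Printing Implicit Defensive.

Import Order.TTheory.

Local Open Scope order_scope.
Local Open Scope quotient_scope.
Local Open Scope classical_set_scope.
Local Open Scope card_scope.

(** * Ordinals

    An ordinal is presented by a well-founded tree, [Sup A f] standing for the
    least ordinal strictly above all the [f a].  The type [ord] is the quotient
    of trees by "same ordinal": a model of the class of ordinals with Leibniz
    equality.  It is well ordered ([ord_wf], [leastP]), its initial segments
    are small ([seg_small]), and every small family is strictly bounded
    ([small_bounded]), where small means indexed by a type in the universe of
    [A].  Sets of ordinals, functions between ordinals, and so on are Rocq
    predicates and functions over [ord]. *)

Inductive tree : Type := Sup (A : Type) (f : A -> tree).

Fixpoint tle (x y : tree) : Prop :=
  match x, y with
  | Sup A f, Sup B g => forall a : A, exists b : B, tle (f a) (g b)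
  end.

Definition tlt (x y : tree) : Prop :=
  let: Sup B g := y in exists b : B, tle x (g b).

Lemma tleP A f y : tle (@Sup A f) y <-> forall a, tlt (f a) y.
Proof. by case: y. Qed.

Lemma tle_refl x : tle x x.
Proof. by elim: x => A f IH /= a; exists a. Qed.

Lemma tle_trans x y z : tle x y -> tle y z -> tle x z.
Proof.
elim: x y z => A f IH [B g] [C h] /= xy yz a.
by have [b ab] := xy a; have [c bc] := yz b; exists c; exact: IH ab bc.
Qed.

Lemma tle_or_tlt x y : tle x y \/ tlt y x.
Proof.
elim: x y => A f IH y.
have [xy|] := pselect (forall a, tlt (f a) y); first by left; apply/tleP.
move=> /existsNP[a na]; right; exists a.
case: y na => B g na /= .
case: (f a) (IH a) na => C k IHa na b.
have [ab|//] := IHa (g b); by case: na; exists b.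
Qed.

Lemma tlt_le x y : tlt x y -> tle x y.
Proof.
elim: y x => B g IH [A f] [b xb]; apply/tleP => a; exists b.
by apply: IH; move/tleP: xb.
Qed.

Lemma tlt_le_trans x y z : tlt x y -> tle y z -> tlt x z.
Proof.
case: y z => [B g] [C h] /= [b xb] yz.
by have [c bc] := yz b; exists c; exact: tle_trans xb bc.
Qed.

Lemma tle_lt_trans x y z : tle x y -> tlt y z -> tlt x z.
Proof.
by case: z => [C h] xy /= [c yc]; exists c; exact: tle_trans xy yc.
Qed.

Lemma tlt_irr x : ~ tlt x x.
Proof.
elim: x => A f IH [a xa]; apply: (IH a).
by apply: tlt_le_trans xa; exists a; exact: tle_refl.
Qed.

HB.instance Definition _ := gen_eqMixin tree.
HB.instance Definition _ := gen_choiceMixin tree.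

Definition teq (x y : tree) : bool := `[< tle x y /\ tle y x >].

Lemma teq_refl : reflexive teq.
Proof. by move=> x; apply/asboolP; split; exact: tle_refl. Qed.

Lemma teq_sym : symmetric teq.
Proof. by move=> x y; apply/asboolP/asboolP => -[]. Qed.

Lemma teq_trans : transitive teq.
Proof.
move=> y x z /asboolP[xy yx] /asboolP[yz zy]; apply/asboolP.
by split; [exact: tle_trans xy yz | exact: tle_trans zy yx].
Qed.

Canonical teq_equiv := EquivRel teq teq_refl teq_sym teq_trans.

Definition ord : Type := {eq_quot teq_equiv}.
HB.instance Definition _ := Choice.on ord.

Definition ord_of (x : tree) : ord := \pi_({eq_quot teq_equiv}) x.
Definition tree_of (a : ord) : tree := repr (a : {eq_quot teq_equiv}).

Lemma tree_ofK : cancel tree_of ord_of.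
Proof. by move=> a; rewrite /ord_of /tree_of reprK. Qed.

Lemma ord_ofE x y : ord_of x = ord_of y <-> tle x y /\ tle y x.
Proof.
split; first by move=> /eqP; rewrite eqmodE => /asboolP.
by move=> xy; apply/eqP; rewrite eqmodE; apply/asboolP.
Qed.

Lemma ord_ofK x : tle (tree_of (ord_of x)) x /\ tle x (tree_of (ord_of x)).
Proof. by apply/ord_ofE; rewrite tree_ofK. Qed.

Definition ole (a b : ord) : bool := `[< tle (tree_of a) (tree_of b) >].

Lemma ole_refl : reflexive ole.
Proof. by move=> a; apply/asboolP; exact: tle_refl. Qed.

Lemma ole_anti : antisymmetric ole.
Proof.
move=> a b /andP[/asboolP ab /asboolP ba].
by rewrite -(tree_ofK a) -(tree_ofK b); apply/ord_ofE.
Qed.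

Lemma ole_trans : transitive ole.
Proof.
by move=> b a c /asboolP ab /asboolP bc; apply/asboolP; exact: tle_trans ab bc.
Qed.

Fact ord_display : Order.disp_t. Proof. exact: Order.Disp tt tt. Qed.

HB.instance Definition _ :=
  Order.Le_isPOrder.Build ord_display ord ole_refl ole_anti ole_trans.

Lemma ole_total : total (<=%O : rel ord).
Proof.
move=> a b; apply/orP.
have [ab|/tlt_le ba] := tle_or_tlt (tree_of a) (tree_of b).
  by left; apply/asboolP.
by right; apply/asboolP.
Qed.

HB.instance Definition _ := Order.POrder_isTotal.Build ord_display ord ole_total.

Lemma le_ord_of x y : ord_of x <= ord_of y <-> tle x y.
Proof.
have [x1 x2] := ord_ofK x; have [y1 y2] := ord_ofK y.
split=> [/asboolP xy|xy].
  exact: tle_trans x2 (tle_trans xy y1).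
by apply/asboolP; exact: tle_trans x1 (tle_trans xy y2).
Qed.

Lemma lt_ord_of x y : ord_of x < ord_of y <-> tlt x y.
Proof.
rewrite ltNge; split=> [/negP yx|xy].
  by have [/le_ord_of //|//] := tle_or_tlt y x.
by apply/negP => /le_ord_of yx; exact: tlt_irr (tlt_le_trans xy yx).
Qed.

Lemma ord_wf : well_founded (fun a b : ord => a < b).
Proof.
suff H x : Acc (fun a b : ord => a < b) (ord_of x).
  by move=> a; rewrite -(tree_ofK a).
elim: x => A f IH; constructor => b; rewrite -(tree_ofK b) => /lt_ord_of[a ba].
constructor => c; rewrite -(tree_ofK c) => /lt_ord_of cb.
by case: (IH a) => H; apply: H; apply/lt_ord_of; exact: tlt_le_trans ba.
Qed.

Definition ord0 : ord := ord_of (Sup (of_void tree)).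
HB.instance Definition _ := isPointed.Build ord ord0.

(** [least P] is meaningful only when [P] is nonempty; see [card_succP],
    [card_succnP], [card_exists] and [covP] for its uses below. *)
Definition least (P : set ord) : ord :=
  xget ord0 [set a | P a /\ forall b, P b -> a <= b].

Lemma leastP (P : set ord) :
  P !=set0 -> P (least P) /\ forall b, P b -> least P <= b.
Proof.
move=> [a Pa]; suff: exists a, P a /\ forall b, P b -> a <= b by exact: xgetPex.
elim/(well_founded_ind ord_wf): a Pa => a IH Pa.
have [le_a|] := pselect (forall b, P b -> a <= b); first by exists a.
by move=> /existsNP[b /not_implyP[Pb /negP]]; rewrite -ltNge => /IH /(_ Pb).
Qed.

(** The ordinal [a] as the set of its predecessors. *)
Definition seg (a : ord) : set ord := [set b | b < a].

Lemma small_bounded (T : Type) (f : T -> tree) :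
  exists b : ord, forall t, ord_of (f t) < b.
Proof.
by exists (ord_of (Sup f)) => t; apply/lt_ord_of; exists t; exact: tle_refl.
Qed.

Fixpoint node (x : tree) : Type :=
  let: Sup A f := x in {a : A & option (node (f a))}.

Fixpoint subtree (x : tree) : node x -> tree :=
  match x with
  | Sup A f => fun n => let: existT a m := n in
                        if m is Some m' then subtree m' else f a
  end.

Lemma tlt_subtree x y : tlt y x <-> exists n : node x, teq y (subtree n).
Proof.
elim: x y => A f IH y; split=> [[a ya]|[[a [m|]] /asboolP[yn ny]]].
- have [fy|yf] := tle_or_tlt (f a) y.
    by exists (existT _ a None); apply/asboolP.
  by have [n yn] := (IH a y).1 yf; exists (existT _ a (Some n)).
- exists a; apply: tlt_le; apply/IH; exists m; exact/asboolP.
- by exists a.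
Qed.

Lemma seg_small (a : ord) :
  exists (T : Type) (f : T -> tree),
    a = ord_of (Sup f) /\ seg a = range (ord_of \o f).
Proof.
exists (node (tree_of a)), (@subtree (tree_of a)).
have E b : b < a <-> exists n, b = ord_of (@subtree (tree_of a) n).
  rewrite -{1}(tree_ofK b) -{1}(tree_ofK a); split.
    move=> /lt_ord_of/tlt_subtree[n /asboolP bn]; exists n.
    by rewrite -(tree_ofK b); exact/ord_ofE.
  move=> [n bn]; apply/lt_ord_of/tlt_subtree; exists n; apply/asboolP.
  by apply/ord_ofE; rewrite tree_ofK.
split; last first.
  apply/seteqP; split=> b; first by move=> /E[n ->]; exists n.
  by move=> [n _ <-]; apply/E; exists n.
apply/le_anti/andP; split.
  rewrite -[leLHS]tree_ofK; apply/le_ord_of.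
  case: (tree_of a) => A f; apply/tleP => t.
  by exists (existT _ t None); exact: tle_refl.
rewrite -[leRHS]tree_ofK; apply/le_ord_of/tleP => n; apply/tlt_subtree.
by exists n; exact: teq_refl.
Qed.

(** * Cardinals *)

Section Rank.
Variables (T : Type) (R : T -> T -> Prop).

Fixpoint rank_acc (t : T) (h : Acc R t) : tree :=
  match h with
  | Acc_intro h' => Sup (fun s : {s : T | R s t} => rank_acc (h' _ (proj2_sig s)))
  end.

Lemma lt_rank_acc s t (hs : Acc R s) (ht : Acc R t) :
  R s t -> tlt (rank_acc hs) (rank_acc ht).
Proof.
move=> Rst; case: ht => h /=; exists (exist _ s Rst) => /=.
by rewrite (Prop_irrelevance hs (h s Rst)); exact: tle_refl.
Qed.

End Rank.

Lemma hartogs_fun (T : Type) :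
  exists a : ord, forall g : ord -> T, ~ set_inj (seg a) g.
Proof.
pose I := ({R : T -> T -> Prop | well_founded R} * T)%type.
have [k kP] := small_bounded (fun i : I => rank_acc (proj2_sig i.1 i.2)).
have [k1 k1P] := small_bounded (fun _ : unit => tree_of k).
have {k1P} kk1 : k < k1 by have := k1P tt; rewrite tree_ofK.
exists k1 => g g_inj.
pose R s t := exists b c, [/\ b < c, c < k1, s = g b & t = g c].
have Rwf : well_founded R.
  suff AR c : c < k1 -> Acc R (g c).
    by move=> t; constructor=> _ [b [c [bc ck -> _]]]; apply: AR; exact: lt_trans ck.
  elim/(well_founded_ind ord_wf): c => c IH ck.
  constructor=> _ [b [d [bd dk -> gcd]]].
  have cd : c = d by apply: g_inj gcd; exact: mem_set.
  by apply: IH; [rewrite cd | rewrite cd in ck; exact: lt_trans ck].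
suff le_rank c : c < k1 -> c <= ord_of (rank_acc (Rwf (g c))).
  by have := kP (exist _ R Rwf, g k); rewrite ltNge le_rank.
elim/(well_founded_ind ord_wf): c => c IH ck.
rewrite leNgt; apply/negP => rc.
suff : ord_of (rank_acc (Rwf (g c))) < ord_of (rank_acc (Rwf (g c))).
  by rewrite ltxx.
apply: le_lt_trans (IH _ rc (lt_trans rc ck)) _.
apply/lt_ord_of/lt_rank_acc.
by exists (ord_of (rank_acc (Rwf (g c)))), c; split.
Qed.

Lemma hartogs (T U : Type) (X : set U) :
  X #<= [set: T] -> exists a : ord, ~ (seg a #<= X).
Proof.
move=> XT; have [a aP] := hartogs_fun (option T); exists a => aX.
have TO : [set: T] #<= [set: option T].
  have /card_eqPle[_ OT] : Some @` [set: T] #= [set: T].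
    by apply: inj_card_eq => x y _ _ [].
  by apply: card_le_trans OT (subset_card_le _).
pose P : pointedType := HB.pack (option T) (gen_eqMixin (option T))
  (gen_choiceMixin (option T)) (isPointed.Build (option T) None).
have /(@pcard_injP _ P)[g] := card_le_trans aX (card_le_trans XT TO).
exact: aP.
Qed.

Definition card_lt T U (A : set T) (B : set U) : Prop :=
  A #<= B /\ ~ (B #<= A).
Notation "A '#<' B" := (card_lt A B) (at level 79) : card_scope.

Definition cardinal (k : ord) : Prop := forall a, a < k -> ~ (seg k #<= seg a).

Definition inf_cardinal (k : ord) : Prop := cardinal k /\ infinite_set (seg k).

Definition card_succ (k : ord) : ord := least [set m | cardinal m /\ k < m].

Definition limit_cardinal (k : ord) : Prop :=
  cardinal k /\ forall m, cardinal m -> m < k -> card_succ m < k.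

Lemma cardinal_unbounded (a : ord) : exists2 k, cardinal k & a < k.
Proof.
have [T [f [_ fa]]] := seg_small a.
have /leastP[] : [set k | ~ (seg k #<= seg a)] !=set0.
  by apply: (@hartogs T); rewrite fa; exact: card_image_le.
set k := least _; move=> ka kmin; exists k; last first.
  rewrite ltNge; apply/negP => kla; apply: ka; apply: subset_card_le => b.
  by move=> /lt_le_trans; exact.
move=> b bk kb; have /contrapT ba : ~ ~ (seg b #<= seg a).
  by move=> /kmin; rewrite leNgt bk.
exact: ka (card_le_trans kb ba).
Qed.

Lemma card_succP (k : ord) :
  [/\ cardinal (card_succ k), k < card_succ k
    & forall m, cardinal m -> k < m -> card_succ k <= m].
Proof.
have [m mc km] := cardinal_unbounded k.
have [|[sc ks] smin] := @leastP [set m | cardinal m /\ k < m]; first by exists m.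
by split=> // n nc kn; apply: smin.
Qed.

(** [card_succn chi a] is $\chi^{+\alpha}$, by recursion on $\alpha$: the least
    cardinal [>= chi] above all the $\chi^{+\beta}$, $\beta<\alpha$
    (see [card_succnE]). *)
Definition card_succn (chi : ord) : ord -> ord :=
  Fix ord_wf (fun _ => ord) (fun a rec =>
    least [set k | [/\ cardinal k, chi <= k
                     & forall b (ba : b < a), rec b ba < k]]).

Lemma card_succnE chi a :
  card_succn chi a = least [set k | [/\ cardinal k, chi <= k
                                      & forall b, b < a -> card_succn chi b < k]].
Proof.
rewrite /card_succn Fix_eq // => x f g fg.
congr least; apply/seteqP; split=> k /= [? ? H]; split=> // b bx;
  [rewrite -fg|rewrite fg]; exact: H.
Qed.

Lemma card_succnP chi a :
  [/\ cardinal (card_succn chi a), chi <= card_succn chi a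
    & forall b, b < a -> card_succn chi b < card_succn chi a].
Proof.
rewrite (card_succnE chi a).
set P := (P in least P); suff /leastP[[]] : P !=set0 by [].
have [T [f [_ fa]]] := seg_small a.
have [c cP] := small_bounded (fun t : T => tree_of (card_succn chi (ord_of (f t)))).
have [k kc] := cardinal_unbounded (Order.max chi c).
rewrite gt_max => /andP[chik ck]; exists k; split=> //; first exact: ltW.
move=> b ba; have: seg a b by []; rewrite fa => -[t _ <-].
by apply: lt_trans ck; rewrite -(tree_ofK (card_succn _ _)); exact: cP.
Qed.

(** Every small set has a cardinality. *)
Lemma card_exists (T U : Type) (X : set U) :
  X #<= [set: T] -> exists2 k, cardinal k & X #= seg k.
Proof.
move=> XT; suff [a Xa] : exists a, X #= seg a.
  have [|Xk kmin] := @leastP [set k | X #= seg k]; first by exists a.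
  exists (least [set k | X #= seg k]) => // b bk kb.
  have : X #= seg b.
    apply/card_eqPle; split; first by rewrite (card_le_eql Xk).
    by rewrite (card_le_eqr Xk); apply: subset_card_le => c /lt_trans; exact.
  by move=> /kmin; rewrite leNgt bk.
have [-> | /set0P[x0 _]] := eqVneq X set0.
  exists ord0; rewrite (_ : seg ord0 = set0) //.
  apply/seteqP; split=> // b; rewrite /seg /= -(tree_ofK b).
  by move=> /lt_ord_of[].
pose P : pointedType := HB.pack U (gen_eqMixin U)
  (gen_choiceMixin U) (isPointed.Build U x0).
pose g : ord -> P := Fix ord_wf (fun _ => P) (fun a rec =>
  xget (x0 : P) [set x | X x /\ forall b (ba : b < a), x <> rec b ba]).
have gE a : g a = xget (x0 : P) [set x | X x /\ forall b, b < a -> x <> g b].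
  rewrite /g Fix_eq // => c h1 h2 h12; congr xget.
  by apply/seteqP; split=> x /= [? H]; split=> // b bc;
    [rewrite -h12|rewrite h12]; exact: H.
pose full a := forall x, X x -> exists2 b, b < a & x = g b.
have gP a : ~ full a -> X (g a) /\ forall b, b < a -> g a <> g b.
  move=> /existsNP[x /not_implyP[Xx nx]]; rewrite (gE a).
  apply: (@xgetPex P x0 [set x | X x /\ forall b, b < a -> x <> g b]).
  by exists x; split=> // b ba xb; apply: nx; exists b.
have g_inj a : (forall b, b < a -> ~ full b) -> set_inj (seg a) g.
  move=> nf b c; rewrite !inE /seg /= => ba ca bc.
  have [bc'|cb|//] := ltgtP b c.
    by have [_ /(_ _ bc')] := gP _ (nf _ ca); case.
  by have [_ /(_ _ cb)] := gP _ (nf _ ba); case.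
have full_ex : full !=set0.
  apply: contrapT => nf; have [a aX] := hartogs XT; apply: aX.
  have nfull b : ~ full b by move=> fb; apply: nf; exists b.
  have /card_eqPle[_ ga] : g @` seg a #= seg a.
    by apply: inj_card_eq; apply: g_inj => b _; exact: nfull.
  apply: card_le_trans ga (subset_card_le _) => _ [b _ <-].
  by have [] := gP _ (nfull b).
have [lf lmin] := leastP full_ex; exists (least full).
have nf b : b < least full -> ~ full b by move=> bl /lmin; rewrite leNgt bl.
have -> : X = g @` seg (least full).
  apply/seteqP; split=> x; first by move=> /lf[b bl ->]; exists b.
  by move=> [b bl <-]; have [] := gP _ (nf _ bl).
by apply: inj_card_eq; exact: g_inj.
Qed.

Definition cof (a : ord) : ord :=
  least [set k | cardinal k /\ exists B : set ord,
    [/\ B `<=` seg a, forall b, b < a -> exists2 c, B c & b <= c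
      & B #= seg k]].

(** Regular cardinals are taken to be infinite. *)
Definition regular (k : ord) : Prop := inf_cardinal k /\ cof k = k.

(** * Covering numbers *)

(** $P_\tau(S)$ *)
Definition Psub (T : Type) (tau : ord) (S : set T) : set (set T) :=
  [set x | x `<=` S /\ x #< seg tau].

(** The requirements on $\rho_1,\rho_2,\rho_3,\rho_4$ under which
    $\mathrm{cov}(\rho_1,\rho_2,\rho_3,\rho_4)$ is considered. *)
Definition cov_dom (r1 r2 r3 r4 : ord) : Prop :=
  [/\ [/\ cardinal r1, cardinal r2, cardinal r3 & cardinal r4],
      r2 <= card_succ r1,
      r3 <= card_succ r2 /\ infinite_set (seg r3)
    & r4 <= r3 /\ `I_2 #<= seg r4].

Definition covers (r1 r2 r3 r4 : ord) (X : set (set ord)) : Prop :=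
  X `<=` Psub r2 (seg r1) /\
  forall b, Psub r3 (seg r1) b ->
    exists2 Q, Psub r4 X Q & b `<=` \bigcup_(q in Q) q.

Definition cov (r1 r2 r3 r4 : ord) : ord :=
  least [set k | cardinal k /\ exists2 X, covers r1 r2 r3 r4 X & X #= seg k].

(** When [r3 <= r2], $P_{\rho_2}(\rho_1)$ itself is covering, so that the
    covering number is attained. *)
Lemma covP r1 r2 r3 r4 : cov_dom r1 r2 r3 r4 -> r3 <= r2 ->
  exists2 X, covers r1 r2 r3 r4 X & X #= seg (cov r1 r2 r3 r4).
Proof.
move=> [_ _ _ [_ two]] r32.
set P := [set k | cardinal k /\ exists2 X, covers r1 r2 r3 r4 X & X #= seg k].
suff /leastP[[]] : P !=set0 by [].
have [T [f [_ fr1]]] := seg_small r1.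
have XT : Psub r2 (seg r1) #<= [set: T -> Prop].
  pose h (x : set ord) : T -> Prop := fun t => x (ord_of (f t)).
  have /card_eqPle[_ hX] : h @` Psub r2 (seg r1) #= Psub r2 (seg r1).
    apply: inj_card_eq => x y; rewrite !inE => -[xr _] [yr _] hxy.
    apply/seteqP; split=> c cx.
      by have := xr _ cx; rewrite fr1 => -[t _ tc]; have := cx; rewrite -tc;
        rewrite -[x _]/(h x t) hxy.
    by have := yr _ cx; rewrite fr1 => -[t _ tc]; have := cx; rewrite -tc;
      rewrite -[y _]/(h y t) -hxy.
  exact: card_le_trans hX (subset_card_le _).
have [k kc Xk] := card_exists XT.
exists k; split=> //; exists (Psub r2 (seg r1)) => //; split=> // b [br1 br3].
have br2 : Psub r2 (seg r1) b.
  split=> //; case: br3 => b3 nb3.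
  have s32 : seg r3 #<= seg r2.
    by apply: subset_card_le => c /lt_le_trans; exact.
  by split; [exact: card_le_trans b3 s32 | move=> /(card_le_trans s32)].
exists [set b]; last by move=> c bc; exists b.
split; first by move=> _ ->.
have b1 : [set b] #= `I_1 by exact: card_set1.
split.
  rewrite (card_le_eql b1); apply: card_le_trans two.
  by apply: subset_card_le => i /= /ltn_trans; exact.
move=> /(card_le_trans two); rewrite (card_le_eqr b1).
by rewrite card_le_II.
Qed.

(** * Products and pcf *)

(** Only the values on [A] matter in [ord_prod A]. *)
Definition ord_prod (A : set ord) : set (ord -> ord) :=
  [set f | forall a, A a -> f a < a].

Definition ideal (A : set ord) (I : set (set ord)) : Prop :=
  [/\ I `<=` [set x | x `<=` A], I set0,
      forall x y, x `<=` y -> I y -> I x,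
      forall x y, I x -> I y -> I (x `|` y) & ~ I A].

Definition sigma_complete (s : ord) (I : set (set ord)) : Prop :=
  forall J, J `<=` I -> J #< seg s -> I (\bigcup_(x in J) x).

Definition lt_mod (A : set ord) (I : set (set ord)) (f g : ord -> ord) : Prop :=
  I [set a | A a /\ g a <= f a].

(** [has_tcf A I p] is $\mathrm{tcf}(\prod A/I)=\pi$. *)
Definition has_tcf (A : set ord) (I : set (set ord)) (p : ord) : Prop :=
  regular p /\ exists f : ord -> ord -> ord,
    [/\ forall a, a < p -> ord_prod A (f a),
        forall a b, a < b -> b < p -> lt_mod A I (f a) (f b)
      & forall g, ord_prod A g -> exists2 a, a < p & lt_mod A I g (f a)].

Definition pcf_com (s : ord) (A : set ord) : set ord :=
  [set p | exists I, [/\ ideal A I, sigma_complete s I & has_tcf A I p]].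

Definition Reg (tau rho theta : ord) : set (set ord) :=
  [set A | [/\ A !=set0, A #< seg tau
             & forall v, A v -> regular v /\ rho < v < theta]].

Definition pcf_strong (chi lambda : ord) : Prop :=
  exists2 s0, s0 < chi & forall s, inf_cardinal s -> s0 <= s -> s < chi ->
    forall A, Reg chi chi lambda A ->
      seg lambda `&` pcf_com s A #< seg chi.

(* Main.v *)
Require Import Defs.
From mathcomp Require Import all_boot all_order.
From mathcomp Require Import boolp classical_sets functions cardinality.

Set Implicit Arguments.
Unset Strict Implicit.
Unset Printing Implicit Defensive.

Import Order.TTheory.

Local Open Scope order_scope.
Local Open Scope classical_set_scope.
Local Open Scope card_scope.

(** Since [lambda < chi^{+chi}], every cardinal in [[chi, lambda]] is
    [chi^{+b}] for some [b < chi], so that fewer than [chi] cardinals lie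
    between [chi] and [lambda] ([cardinals_between]).  Both conclusions come
    from this count.

    Strength: a set [A] of regular cardinals above [chi] has no true cofinality
    [p <= chi], because [p] functions in the product are then bounded pointwise
    by regularity ([pcf_com_gt]).  Hence [pcf_com s A] meets [lambda] only in
    cardinals between [chi] and [lambda].

    Covering: let [tau < chi] be infinite and bound the number of cardinals in
    [[chi, lambda)], and let [sigma = tau^+].  By induction on [g <= lambda], the
    subsets of [g] of size at most [chi] are covered, [tau] at a time, by a
    family of at most [lambda] such subsets ([small_cover_seg]).  If
    [g <= chi], the single set [g] is enough.  If [g] is not a cardinal, the family is carried over from a smaller ordinal.  If
    [g > chi] is a cardinal, the union of the families of all smaller ordinals
    works.  Indeed, either [g] is a successor cardinal, and every small subset is
    bounded, hence already dealt with below; or the cardinals below [g] are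
    cofinal, and a small subset is the union of its traces on at most [tau]
    smaller ordinals, each trace being covered by [tau] sets.  The cardinalities
    are controlled by Hessenberg's theorem ([seg_square]) through its consequence
    on unions ([card_bigcup_le]). *)

(** * Cardinal arithmetic *)

Lemma card_le_ordP (T : Type) (A : set T) (B : set ord) :
  A #<= B <->
  exists f : T -> ord, (forall x, A x -> B (f x)) /\
                       (forall x y, A x -> A y -> f x = f y -> x = y).
Proof.
split=> [/pcard_leP|[f [fB fI]]].
  move=> /injfunPex[f fB fI]; exists f; split=> [x /fB //|x y Ax Ay].
  by apply: fI; exact: mem_set.
by apply/pcard_leP/injfunPex; exists f => // x y; rewrite !inE => ? ?; exact: fI.
Qed.

Lemma seg_le a b : a <= b -> seg a #<= seg b.
Proof. by move=> ab; apply: subset_card_le => c /lt_le_trans; exact. Qed.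

Lemma cardinal_le k a : cardinal k -> seg k #<= seg a -> k <= a.
Proof. by move=> kc ka; rewrite leNgt; apply/negP => /kc. Qed.

Lemma card_exists_seg (T : Type) (X : set T) a :
  X #<= seg a -> exists k, [/\ cardinal k, X #= seg k & k <= a].
Proof.
move=> Xa; have [T' [f [_ fa]]] := seg_small a.
have [|k kc Xk] := @card_exists T' T X.
  by apply: card_le_trans Xa _; rewrite fa; exact: card_image_le.
exists k; split=> //; apply: cardinal_le => //.
by rewrite -(card_le_eql Xk).
Qed.

Lemma infinite_le (T U : Type) (A : set T) (B : set U) :
  infinite_set A -> A #<= B -> infinite_set B.
Proof. by move=> /[swap] AB iA fB; apply: iA; exact: card_le_finite AB fB. Qed.

Lemma seg_ltn0 k : infinite_set (seg k) -> Defs.ord0 < k.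
Proof.
move=> /infinite_setN0[a ak]; rewrite ltNge; apply/negP => k0.
have := lt_le_trans ak k0.
by rewrite -(tree_ofK a) => /lt_ord_of[].
Qed.

(** The shift [e n |-> e n.+1] along a copy [e] of the natural numbers in [A]
    makes room for [x]. *)
Lemma infinite_absorb1 (A : set ord) (x : ord) :
  infinite_set A -> A `|` [set x] #<= A.
Proof.
move=> iA; have [Ax|nAx] := pselect (A x).
  by apply: subset_card_le => y [|->].
move: iA => /infiniteP/card_le_ordP[e [eA eI]].
have e_inj m n : e m = e n -> m = n by exact: eI.
pose h y := if pselect (exists n, y = e n) is left h then e (projT1 (cid h)).+1
            else if y == x then e 0%N else y.
have hE n : h (e n) = e n.+1.
  rewrite /h; case: pselect => [p|[]]; last by exists n.
  by case: cid => m /= /e_inj ->.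
have hx : h x = e 0%N.
  rewrite /h; case: pselect => [[n xe]|_]; last by rewrite eqxx.
  by case: nAx; rewrite xe; exact: eA.
have hA y : ~ (exists n, y = e n) -> A y -> h y = y.
  rewrite /h; case: pselect => // _ _ Ay; case: eqP => // yx.
  by case: nAx; rewrite -yx.
have cases y : (A `|` [set x]) y ->
    [\/ exists n, y = e n, y = x | ~ (exists n, y = e n) /\ A y].
  move=> [Ay|->]; last exact: Or32.
  by have [yn|yn] := pselect (exists n, y = e n); [exact: Or31|exact: Or33].
apply/card_le_ordP; exists h; split.
  move=> y /cases[[n ->]|->|[yn Ay]]; rewrite ?hE ?hx; [exact: eA|exact: eA|].
  by rewrite hA.
move=> y z /cases[[n ->]|->|[yn Ay]] /cases[[m ->]|->|[zm Az]];
  rewrite ?hE ?hx ?hA //.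
- by move/e_inj => [->].
- by move/e_inj.
- by move=> zE; case: zm; exists n.+1.
- by move/e_inj.
- by move=> zE; case: zm; exists 0%N.
- by move=> yE; case: yn; exists m.+1.
- by move=> yE; case: yn; exists 0%N.
Qed.

(** Otherwise [k] would be the successor ordinal of [m], and equinumerous
    with it. *)
Lemma inf_cardinal_limit k m : inf_cardinal k -> m < k ->
  exists2 s, m < s & s < k.
Proof.
move=> [kc ki] mk; apply: contrapT => ns.
have kS : seg k `<=` seg m `|` [set m].
  move=> c ck; have [cm|mc|->] := ltgtP c m; [by left| |by right].
  by case: ns; exists c.
have km := subset_card_le kS.
have [mf|mi] := pselect (finite_set (seg m)).
  by apply: ki; apply: (card_le_finite km); rewrite finite_setU; split.
by apply: (kc _ mk); exact: card_le_trans km (infinite_absorb1 m mi).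
Qed.

(** Goedel's well-ordering of pairs, by maximum and then lexicographically: all
    predecessors of [p] lie in the square of the ordinals up to the larger
    coordinate of [p]. *)
Definition pair_lt (p q : ord * ord) : Prop :=
  let mp := Order.max p.1 p.2 in let mq := Order.max q.1 q.2 in
  mp < mq \/ (mp = mq /\ (p.1 < q.1 \/ (p.1 = q.1 /\ p.2 < q.2))).

Lemma pair_lt_wf : well_founded pair_lt.
Proof.
suff H m a b : Order.max a b = m -> Acc pair_lt (a, b).
  by case=> a b; exact: (H (Order.max a b)).
elim/(well_founded_ind ord_wf): m a b => m IHm a.
elim/(well_founded_ind ord_wf): a => a IHa b.
elim/(well_founded_ind ord_wf): b => b IHb abm.
constructor=> -[c d] [/= lt_m|[/= eq_m [ca|[cE db]]]].
- by apply: IHm erefl; rewrite -abm.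
- by apply: IHa ca _ _; exact: etrans eq_m abm.
- by rewrite cE in eq_m *; apply: IHb db _; exact: etrans eq_m abm.
Qed.

Lemma pair_lt_total p q : p <> q -> pair_lt p q \/ pair_lt q p.
Proof.
case: p q => [a b] [c d] ne; rewrite /pair_lt /=.
have [mm|mm|mm] := ltgtP (Order.max a b) (Order.max c d);
  [by left; left|by right; left|].
have [ac|ca|ac] := ltgtP a c;
  [by left; right; split=> //; left|by right; right; split=> //; left|].
have [bd|db|bd] := ltgtP b d.
- by left; right; split=> //; right.
- by right; right; split=> //; right.
- by case: ne; rewrite ac bd.
Qed.

(** Each pair takes the first code left free by its predecessors.  Such a code
    exists for the pairs considered below by a counting argument; elsewhere the
    value is the default one of [least]. *)
Definition pair_code : ord * ord -> ord :=
  Fix pair_lt_wf (fun _ => ord) (fun p rec =>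
    least [set c | forall q (qp : pair_lt q p), rec q qp <> c]).

Lemma pair_codeE p :
  pair_code p = least [set c | forall q, pair_lt q p -> pair_code q <> c].
Proof.
rewrite /pair_code Fix_eq // => x f g fg.
congr least; apply/seteqP; split=> c /= H q qx;
  [rewrite -fg|rewrite fg]; exact: H.
Qed.

(** Hessenberg's theorem, by induction on [k].  For a cardinal [k], the
    predecessors of a pair lie in the square of some [s < k], so by induction
    they have used up fewer than [k] codes, and the pair finds a free one
    below [k]. *)
Lemma seg_square k : infinite_set (seg k) -> seg k `*` seg k #<= seg k.
Proof.
elim/(well_founded_ind ord_wf): k => k IH ki.
have [kc|] := pselect (cardinal k); last first.
  move=> /existsNP[a /not_implyP[ak /contrapT ka]].
  have aa := IH a ak (infinite_le ki ka).
  apply: card_le_trans (seg_le (ltW ak)); apply: card_le_trans aa.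
  have [f [fa fI]] := (card_le_ordP _ _).1 ka.
  apply/pcard_leP/injfunPex; exists (fun p => (f p.1, f p.2)).
    by move=> [x y] [/= xk yk]; split; exact: fa.
  move=> [x y] [z w]; rewrite !inE => -[/= xk yk] [/= zk wk] [xz yw].
  by rewrite (fI _ _ xk zk xz) (fI _ _ yk wk yw).
have codeP p : (seg k `*` seg k) p ->
    pair_code p < k /\ forall q, pair_lt q p -> pair_code q <> pair_code p.
  move=> [p1 p2].
  have [s ms sk] : exists2 s, Order.max p.1 p.2 < s & s < k.
    by apply: inf_cardinal_limit => //; rewrite gt_max p1 p2.
  (* the codes that are already taken when the turn of [p] comes *)
  pose U := pair_code @` [set q | pair_lt q p].
  have UE : U #<= seg s `*` seg s.
    apply: card_le_trans (card_image_le _ _) (subset_card_le _) => -[a b] /= qp.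
    have : Order.max a b < s.
      by case: qp => [/= /lt_trans|[/= -> _]]; [exact|].
    by rewrite gt_max => /andP[].
  have [c ck cU] : exists2 c, c < k & ~ U c.
    apply: contrapT => nc.
    have kU : seg k #<= U.
      apply: subset_card_le => c ck; apply: contrapT => cU.
      by apply: nc; exists c.
    have ks := card_le_trans kU UE.
    have [sf|si] := pselect (finite_set (seg s)).
      by apply: ki; apply: (card_le_finite ks); exact: finite_setX.
    exact: (kc _ sk (card_le_trans ks (IH s sk si))).
  rewrite (pair_codeE p).
  have cP : [set c | forall q, pair_lt q p -> pair_code q <> c] c.
    by move=> q qp qc; apply: cU; exists q.
  have [lP lmin] := leastP (ex_intro _ c cP).
  by split=> //; exact: le_lt_trans (lmin _ cP) ck.
apply/card_le_ordP; exists pair_code; split=> [p /codeP[]//|p q pk qk pq].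
apply: contrapT => /pair_lt_total[lt|lt].
  by have [_ /(_ _ lt)] := codeP _ qk.
by have [_ /(_ _ lt)] := codeP _ pk; rewrite pq.
Qed.

(** A point of the union is coded by an index [j x] of a set that contains it,
    together with its place in that set: this injects the union into the
    square of [k]. *)
Lemma card_bigcup_le (I T : Type) (D : set I) (F : I -> set T) k :
  infinite_set (seg k) -> D #<= seg k -> (forall i, D i -> F i #<= seg k) ->
  \bigcup_(i in D) F i #<= seg k.
Proof.
move=> ki /card_le_ordP[d [dk dI]] Fk.
have [[i0 Di0]|D0] := pselect (D !=set0); last first.
  rewrite (_ : \bigcup_(i in D) F i = set0) ?card_ge0 //.
  by apply/seteqP; split=> // x [i Di _]; case: D0; exists i.
have /choice[e eP] : forall i, exists f : T -> ord, D i ->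
    (forall x, F i x -> f x < k) /\
    (forall x y, F i x -> F i y -> f x = f y -> x = y).
  move=> i; have [Di|nDi] := pselect (D i); last by exists (fun=> Defs.ord0).
  by have [f fP] := (card_le_ordP _ _).1 (Fk i Di); exists f.
have /choice[j jP] : forall x, exists i : I,
    (\bigcup_(i in D) F i) x -> D i /\ F i x.
  move=> x; have [[i Di Fx]|nx] := pselect ((\bigcup_(i in D) F i) x).
    by exists i.
  by exists i0.
apply: card_le_trans (seg_square ki).
apply/pcard_leP/injfunPex; exists (fun x => (d (j x), e (j x) x)).
  move=> x /jP[Dj Fj]; split; first exact: dk.
  exact: (eP _ Dj).1.
move=> x y; rewrite !inE => /jP[Dx Fx] /jP[Dy Fy] [dxy exy].
have jxy := dI _ _ Dx Dy dxy.
by rewrite -jxy in Fy exy; exact: (eP _ Dx).2 exy.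
Qed.

(** * Covering families *)

(** The size of the family is bounded by one fixed [lambda], and that of
    subfamilies by an inclusive [tau], so that unions of at most [lambda]
    families, or of at most [tau] subfamilies, stay within the same bounds. *)
Definition small_cover (chi lambda tau : ord) (T : Type) (Y : set T) : Prop :=
  exists X : set (set T), [/\ X #<= seg lambda,
    forall x, X x -> x `<=` Y /\ x #<= seg chi
    & forall b, b `<=` Y -> b #<= seg chi ->
        exists Q, [/\ Q `<=` X, Q #<= seg tau & b `<=` \bigcup_(q in Q) q]].

Lemma set1_le (T : Type) (x : T) k : infinite_set (seg k) -> [set x] #<= seg k.
Proof.
move=> /seg_ltn0 k0; apply/card_le_ordP; exists (fun=> Defs.ord0).
by split=> // y z -> ->.
Qed.

Lemma small_cover_small chi lambda tau (T : Type) (Y : set T) :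
  infinite_set (seg lambda) -> infinite_set (seg tau) -> Y #<= seg chi ->
  small_cover chi lambda tau Y.
Proof.
move=> li ti Yc; exists [set Y]; split; [exact: set1_le|by move=> x ->; split|].
move=> b bY _; exists [set Y]; split=> //; first exact: set1_le.
by move=> y /bY Yy; exists Y.
Qed.

(** The covering family of [Z] is pulled back along an injection of [Y] into
    [Z]. *)
Lemma small_cover_le chi lambda tau (Y Z : set ord) :
  Y #<= Z -> small_cover chi lambda tau Z -> small_cover chi lambda tau Y.
Proof.
move=> /card_le_ordP[f [fZ fI]] [X [Xl Xc XQ]].
pose pull (x : set ord) := Y `&` f @^-1` x.
exists (pull @` X); split.
- exact: card_le_trans (card_image_le _ _) Xl.
- move=> _ [x /Xc[xZ xc] <-]; split; first by move=> y [].
  apply: card_le_trans xc; apply/card_le_ordP; exists f; split; first by move=> y [_ xy]; exact: xy.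
  by move=> y z [Yy _] [Yz _]; exact: fI.
- move=> b bY bc; have [|Q [QX Qt Qb]] := XQ (f @` b) _ (card_le_trans (card_image_le _ _) bc).
    by move=> _ [y /bY /fZ Zy <-].
  exists (pull @` Q); split; first exact: image_subset.
    exact: card_le_trans (card_image_le _ _) Qt.
  move=> y yb; have [|q Qq qy] := Qb (f y); first by exists y.
  by exists (pull q); [exists q|split=> //; exact: bY].
Qed.

(** The union of the families of the pieces [Y i] works as soon as every small
    set meets its share of the pieces: [D] is a single index when small sets are
    bounded, and a short cofinal set of indices otherwise. *)
Lemma small_cover_bigcup chi lambda tau (I T : Type) (C : set I) (Y : I -> set T) :
  infinite_set (seg lambda) -> infinite_set (seg tau) -> C #<= seg lambda ->
  (forall i, C i -> small_cover chi lambda tau (Y i)) ->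
  (forall b, b `<=` \bigcup_(i in C) Y i -> b #<= seg chi ->
     exists D, [/\ D `<=` C, D #<= seg tau & b `<=` \bigcup_(i in D) Y i]) ->
  small_cover chi lambda tau (\bigcup_(i in C) Y i).
Proof.
move=> li ti Cl CY CD.
have /choice[X XP] : forall i, exists X : set (set T), C i ->
    [/\ X #<= seg lambda, forall x, X x -> x `<=` Y i /\ x #<= seg chi
      & forall b, b `<=` Y i -> b #<= seg chi ->
        exists Q, [/\ Q `<=` X, Q #<= seg tau & b `<=` \bigcup_(q in Q) q]].
  move=> i; have [/CY[X XP]|nCi] := pselect (C i); first by exists X.
  by exists set0.
exists (\bigcup_(i in C) X i); split.
- by apply: card_bigcup_le => // i /XP[].
- move=> x [i Ci Xx]; have [_ /(_ _ Xx)[xY xc] _] := XP i Ci.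
  by split=> // y /xY; exists i.
- move=> b bY bc; have [D [DC Dt Db]] := CD b bY bc.
  have /choice[Q QP] : forall i, exists Q : set (set T), D i ->
      [/\ Q `<=` X i, Q #<= seg tau & b `&` Y i `<=` \bigcup_(q in Q) q].
    move=> i; have [Di|nDi] := pselect (D i); last by exists set0.
    have [_ _ /(_ (b `&` Y i))[|| Q QP]] := XP i (DC _ Di).
    + by move=> y [].
    + by apply: card_le_trans bc; apply: subset_card_le => y [].
    + by exists Q.
  exists (\bigcup_(i in D) Q i); split.
  + by move=> q [i Di Qq]; exists i; [exact: DC|have [QX _ _] := QP i Di; exact: QX].
  + by apply: card_bigcup_le => // i /QP[].
  + move=> y yb; have [i Di Yy] := Db _ yb.
    have [_ _ /(_ y (conj yb Yy))[q Qq qy]] := QP i Di.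
    by exists q => //; exists i.
Qed.

(** The bound [a] makes [g] a successor cardinal, and successors are regular:
    all ordinals below [g] have size at most that of [e], the maximum of [a] and
    [chi], and an unbounded [b] would write [g] as a union of at most [chi] of
    them. *)
Lemma small_bounded_succ chi g a b :
  inf_cardinal g -> infinite_set (seg chi) -> chi < g -> a < g ->
  (forall k, cardinal k -> k < g -> k <= a) ->
  b `<=` seg g -> b #<= seg chi ->
  exists2 e, e < g & b `<=` seg e.
Proof.
move=> gi ci cg ag ka bg bc; apply: contrapT => nb; have [gc _] := gi.
set e := Order.max a chi.
have eg : e < g by rewrite gt_max ag cg.
have se t : t < g -> seg t #<= seg e.
  move=> tg; have [k [kc tk kt]] := card_exists_seg (card_lexx (seg t)).
  rewrite (card_le_eql tk); apply: seg_le.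
  by apply: le_trans (ka _ kc (le_lt_trans kt tg)) _; rewrite le_max lexx.
have ce : seg chi #<= seg e by apply: seg_le; rewrite le_max lexx orbT.
apply: (gc _ eg); apply: card_le_trans (card_bigcup_le (D := b) (F := seg) _ _ _).
- apply: subset_card_le => x xg; have [s xs sg] := inf_cardinal_limit gi xg.
  apply: contrapT => nx; apply: nb; exists s => // y yb.
  rewrite /seg /= ltNge; apply/negP => sy; apply: nx; exists y => //.
  exact: lt_le_trans xs sy.
- exact: infinite_le ce.
- exact: card_le_trans bc ce.
- by move=> t /bg; exact: se.
Qed.

(** The hypothesis on [tau] is what lets a short cofinal set of cardinals serve
    at every limit cardinal of the induction. *)
Lemma small_cover_seg chi lambda tau :
  cardinal lambda -> infinite_set (seg chi) -> chi < lambda ->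
  infinite_set (seg tau) ->
  [set k | [/\ cardinal k, chi <= k & k < lambda]] #<= seg tau ->
  small_cover chi lambda tau (seg lambda).
Proof.
move=> lc ci cl ti Kt.
have li : infinite_set (seg lambda) := infinite_le ci (seg_le (ltW cl)).
suff H g : g <= lambda -> small_cover chi lambda tau (seg g) by exact: H.
elim/(well_founded_ind ord_wf): g => g IH gl.
have [gc|] := pselect (cardinal g); last first.
  move=> /existsNP[a /not_implyP[ag /contrapT ga]].
  apply: (small_cover_le ga); apply: IH => //.
  exact: ltW (lt_le_trans ag gl).
have [gchi|cg] := leP g chi.
  by apply: small_cover_small => //; exact: seg_le.
have gi : inf_cardinal g.
  by split=> //; exact: infinite_le ci (seg_le (ltW cg)).
have gE : seg g = \bigcup_(i in seg g) seg i.
  apply/seteqP; split=> x; last by move=> [i ig xi]; exact: lt_trans ig.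
  by move=> xg; have [s xs sg] := inf_cardinal_limit gi xg; exists s.
rewrite gE; apply: small_cover_bigcup => //; first exact: seg_le.
  by move=> i ig; apply: IH => //; exact: ltW (lt_le_trans ig gl).
rewrite -gE => b bg bc.
have [[a ag ka]|ncof] := pselect (exists2 a, a < g &
    forall k, cardinal k -> k < g -> k <= a).
  have [e eg be] := small_bounded_succ gi ci cg ag ka bg bc.
  (* small subsets are bounded: one smaller ordinal is enough *)
  exists [set e]; split; [by move=> _ ->|exact: set1_le|].
  by move=> x /be xe; exists e.
(* the cardinals are cofinal in [g], and there are at most [tau] of them *)
exists [set k | [/\ cardinal k, chi <= k & k < g]]; split.
- by move=> k [].
- apply: card_le_trans Kt; apply: subset_card_le => k [? ? kg]; split=> //.
  exact: lt_le_trans gl.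
- move=> x /bg xg.
  have mg : Order.max x chi < g by rewrite gt_max xg cg.
  apply: contrapT => nx; apply: ncof; exists (Order.max x chi) => // k kc kg.
  rewrite leNgt gt_max; apply/negP => /andP[xk ck]; apply: nx.
  by exists k => //; split=> //; exact: ltW.
Qed.

(** * True cofinalities *)

Lemma regular_bounded a p (h : ord -> ord) :
  regular a -> p < a -> (forall t, t < p -> h t < a) ->
  exists2 e, e < a & forall t, t < p -> h t <= e.
Proof.
move=> [_ acof] pa ha; apply: contrapT => ne.
have [k [kc hk kp]] := card_exists_seg (card_image_le h (seg p)).
have P : [set k | cardinal k /\ exists B : set ord,
    [/\ B `<=` seg a, forall b, b < a -> exists2 c, B c & b <= c
      & B #= seg k]] k.
  split=> //; exists (h @` seg p); split=> //.
    by move=> _ [t tp <-]; exact: ha.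
  move=> b ba; apply: contrapT => nb; apply: ne; exists b => // t tp.
  rewrite leNgt; apply/negP => bh; apply: nb.
  by exists (h t); [exists t|exact: ltW].
have [_ /(_ _ P)] := leastP (ex_intro _ k P).
by rewrite -/(cof a) acof leNgt (le_lt_trans kp pa).
Qed.

(** A scale of length at most [chi] would be bounded pointwise by some [g] in
    the product, since the members of [A] are regular and above [chi]; as some
    member of the scale lies above [g] modulo the ideal, [A] would be in the
    ideal. *)
Lemma pcf_com_gt s A p chi :
  (forall v, A v -> regular v /\ chi < v) -> pcf_com s A p -> chi < p.
Proof.
move=> Areg [I [[_ _ _ _ IA] _ [_ [f [fA _ fcof]]]]].
rewrite ltNge; apply/negP => pchi.
have /choice[g gP] : forall v, exists e, A v ->
    e < v /\ forall t, t < p -> f t v <= e.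
  move=> v; have [Av|nAv] := pselect (A v); last by exists Defs.ord0.
  have [vr cv] := Areg v Av.
  have [|e ev fe] := @regular_bounded v p (f^~ v) vr (le_lt_trans pchi cv).
    by move=> t tp; exact: fA.
  by exists e.
have [|t tp] := fcof g; first by move=> v /gP[].
rewrite /lt_mod (_ : [set a | _] = A) //.
by apply/seteqP; split=> [v []|v Av] //; split=> //; have [_] := gP v Av; exact.
Qed.

(** * Cardinal successors and covering numbers *)

(** Take the least [b] with [k <= card_succn chi b]: then [k] satisfies the
    requirements of which [card_succn chi b] is the least solution. *)
Lemma card_succn_onto chi a k :
  cardinal k -> chi <= k -> k < card_succn chi a ->
  exists2 b, b < a & k = card_succn chi b.
Proof.
move=> kc ck ka.
have Pa : [set b | k <= card_succn chi b] a by exact: ltW.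
have [kb bmin] := leastP (ex_intro _ a Pa).
set b := least _ in kb bmin; have {}kb : k <= card_succn chi b by [].
have bk : card_succn chi b <= k.
  have Pk : [set k | [/\ cardinal k, chi <= k
      & forall c, c < b -> card_succn chi c < k]] k.
    split=> // c cb; rewrite ltNge; apply/negP => kc'.
    by have := bmin c kc'; rewrite leNgt cb.
  by rewrite card_succnE; have [_] := leastP (ex_intro _ k Pk); exact.
have kE : k = card_succn chi b by apply/le_anti; rewrite kb bk.
exists b => //; rewrite lt_neqAle bmin // andbT; apply/eqP => ba.
by rewrite kE ba ltxx in ka.
Qed.

Lemma cardinals_between chi lambda :
  cardinal chi -> cardinal lambda -> chi <= lambda ->
  lambda < card_succn chi chi ->
  exists2 d, d < chi &
    [set k | [/\ cardinal k, chi <= k & k < lambda]] #<= seg d.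
Proof.
move=> cc lc cl lt; have [d dc lE] := card_succn_onto lc cl lt.
exists d => //; apply: card_le_trans (card_image_le (card_succn chi) _).
apply: subset_card_le => k [kc ck kl].
have [|b bd kE] := @card_succn_onto chi d k kc ck; first by rewrite -lE.
by exists b.
Qed.

Lemma uncountable_gt_infinite chi :
  ~ countable (seg chi) -> exists2 w, w < chi & infinite_set (seg w).
Proof.
move=> cu; have [w _ wE] := card_exists (card_lexx [set: nat]).
have [wn nw] : (seg w #<= [set: nat]) /\ ([set: nat] #<= seg w).
  by have /card_eqPle[] := wE.
exists w; last exact/infiniteP.
rewrite ltNge; apply/negP => cw; apply: cu.
exact: card_le_trans (seg_le cw) wn.
Qed.

Lemma card_le_lt (T : Type) (X : set T) k m :
  cardinal m -> k < m -> X #<= seg k -> X #< seg m.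
Proof.
move=> mc km Xk; split; first exact: card_le_trans Xk (seg_le (ltW km)).
by move=> /card_le_trans /(_ Xk); exact: mc.
Qed.

Lemma lt_card_succ (T : Type) (X : set T) k :
  X #< seg (card_succ k) -> X #<= seg k.
Proof.
move=> [Xs nsX]; have [m [mc Xm _]] := card_exists_seg Xs.
rewrite (card_le_eql Xm); apply: seg_le; rewrite leNgt; apply/negP => km.
apply: nsX; rewrite (card_le_eqr Xm); apply: seg_le.
by have [_ _] := card_succP k; exact.
Qed.

Lemma cov_le r1 r2 r3 r4 X k :
  covers r1 r2 r3 r4 X -> X #<= seg k -> cov r1 r2 r3 r4 <= k.
Proof.
move=> Xc Xk; have [m [mc Xm mk]] := card_exists_seg Xk.
have P : [set k | cardinal k /\ exists2 X, covers r1 r2 r3 r4 X & X #= seg k] m.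
  by split=> //; exists X.
by have [_ /(_ _ P)] := leastP (ex_intro _ m P) => /le_trans; exact.
Qed.

Theorem proposition2p4 (chi lambda : ord)
    (chi_limit : limit_cardinal chi) (chi_uncountable : ~ countable (seg chi))
    (lambda_card : cardinal lambda)
    (chi_lt_lambda : chi < lambda) (lambda_lt : lambda < card_succn chi chi) :
  pcf_strong chi lambda /\
  exists sigma : ord, [/\ sigma < chi,
    cov_dom lambda (card_succ chi) (card_succ chi) sigma
    & cov lambda (card_succ chi) (card_succ chi) sigma <= lambda].
Proof.
have [chi_card chi_succ] := chi_limit.
have [d dc Kd] := cardinals_between chi_card lambda_card (ltW chi_lt_lambda) lambda_lt.
have [w wc wi] := uncountable_gt_infinite chi_uncountable.
have chi_inf : infinite_set (seg chi) := infinite_le wi (seg_le (ltW wc)).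
split.
  exists Defs.ord0; first exact: seg_ltn0.
  move=> s _ _ _ A [_ _ Areg]; apply: (card_le_lt chi_card dc).
  apply: card_le_trans Kd; apply: subset_card_le => p [pl ps].
  split=> //; first by have [I [_ _ [[[]]]]] := ps.
  apply/ltW; apply: pcf_com_gt ps => v /Areg[vr /andP[]].
  by [].
(* an infinite cardinal below [chi] that counts the cardinals in between *)
have [tau [tau_card tauE tau_max]] := card_exists_seg (card_lexx (seg (Order.max d w))).
have le_tau a : a <= Order.max d w -> seg a #<= seg tau.
  by move=> /seg_le; rewrite (card_le_eqr tauE).
have tau_chi : tau < chi by apply: le_lt_trans tau_max _; rewrite gt_max dc wc.
have tau_inf : infinite_set (seg tau).
  by apply: infinite_le wi (le_tau _ _); rewrite le_max lexx orbT.
have Kt : [set k | [/\ cardinal k, chi <= k & k < lambda]] #<= seg tau.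
  by apply: card_le_trans Kd (le_tau _ _); rewrite le_max lexx.
have [sig_card tau_sig _] := card_succP tau.
have [chip_card chi_chip chip_min] := card_succP chi.
have [lamp_card lam_lamp _] := card_succP lambda.
have [chipp_card chip_chipp _] := card_succP (card_succ chi).
have sig_chi : card_succ tau < chi by exact: chi_succ.
exists (card_succ tau); split=> //.
  split=> //; first exact: le_trans (chip_min _ lambda_card chi_lt_lambda) (ltW lam_lamp).
    by split; [exact: ltW|exact: infinite_le chi_inf (seg_le (ltW chi_chip))].
  split; first exact: ltW (lt_trans sig_chi chi_chip).
  have /infiniteP := infinite_le tau_inf (seg_le (ltW tau_sig)).
  exact: card_le_trans (subset_card_le _).
have [X [Xl Xc XQ]] :=
  small_cover_seg lambda_card chi_inf chi_lt_lambda tau_inf Kt.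
apply: (cov_le (X := X)) => //; split=> [x /Xc[xl xc]|b [bl /lt_card_succ bc]].
  by split=> //; exact: card_le_lt chi_chip xc.
have [Q [QX Qt Qb]] := XQ b bl bc.
by exists Q => //; split=> //; exact: card_le_lt tau_sig Qt.
Qed.
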